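(* Let $X$ be a set, let $F=F_X$ be the free group on the basis $X$, let $R$ be a unital commutative ring, and let $e$ be a multiplicatively descending map. Then for every integer $n\ge1$, \[ \mu_R^{-1}(1+\mathfrak{d}_R^{(e,n)})=\bigcap_{d=1}^{n-1}\ \bigcap\Bigl\{\ker(\varphi)\ \Bigm|\ \varphi\in\mathrm{Hom}\bigl(F,\mathbb{U}_{d+1}(R/e(n,d)R)\bigr)\Bigr\} =\bigcap_{d=1}^{n-1}\ \bigcap_{w\in X^*,\ |w|=d}\ker(\varphi_{R/e(n,d)R,\,w}). \]
   Context: A map $e\colon\{(n,i)\in\mathbb{Z}^2 \mid 1\le i\le n\}\to\mathbb{Z}_{\ge0}$ is called multiplicatively descending if (i) $e(n,n)=1$ for every $n$; and (ii) $e(n,i)\in e(n,i+1)\mathbb{Z}$ for every $1\le i<n$. For a unital commutative ring $S$: $S\langle X\rangle$ is the free associative $S$-algebra on $X$, graded by total degree with homogeneous components $S\langle X\rangle^{(n)}$, and $S\langle\langle X\rangle\rangle=\prod_{n=0}^\infty S\langle X\rangle^{(n)}$. $\mathfrak{d}_S$ is the ideal of $S\langle\langle X\rangle\rangle$ generated by $X$, and $\mathfrak{d}_R^{(e,n)}=\sum_{i=1}^n e(n,i)\mathfrak{d}_R^i$. The Magnus homomorphism $\mu_S\colon F\to S\langle\langle X\rangle\rangle^\times$ is the group homomorphism with $\mu_S(x)=1+x$ for $x\in X$. $\mathbb{U}_n(S)$ is the group of $n\times n$ upper-triangular unipotent matrices over $S$. $X^*$ is the free monoid on $X$ (finite words in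 the alphabet $X$), and $|w|$ is the length of $w\in X^*$. For $g\in F$ write $\mu_S(g)=\sum_{w\in X^*}\mu_{S,w}(g)w$ with $\mu_{S,w}(g)\in S$. For a word $w=(x_1\cdots x_d)$ of length $d$, $\varphi_{S,w}\colon F\to\mathbb{U}_{d+1}(S)$ is the group homomorphism whose $(i,j)$-entry is $(\varphi_{S,w}(g))_{ij}=\mu_{S,(x_i\cdots x_{j-1})}(g)$ for $1\le i<j\le d+1$. An empty intersection of subgroups of $F$ is $F$. *)

(* Defs.v *)
From HB Require Import structures.
From mathcomp Require Import all_boot all_algebra.
From mathcomp Require Import mathcomp_extra boolp classical_sets functions cardinality.

Set Implicit Arguments.
Unset Strict Implicit.
Unset Printing Implicit Defensive.

Import GRing.Theory.

Local Open Scope ring_scope.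
Local Open Scope classical_set_scope.

(* The map e has domain {(n, i) | 1 <= i <= n}; its values elsewhere are
   unconstrained and unused. *)
Definition mult_descending (e : nat -> nat -> nat) : Prop :=
  (forall n, (1 <= n)%N -> e n n = 1%N) /\
  (forall n i, (1 <= i < n)%N -> (e n i.+1 %| e n i)%N).

(* Between groups, maps preserving 1 and products are all the homomorphisms. *)
Notation ghom G H := (UMagmaMorphism.type G H).

Definition gker (G H : groupType) (f : G -> H) : set G :=
  [set g | f g = 1%g].

Section FreeGroup.
Variable X : choiceType.

(* (x, false) stands for x, and (x, true) for its inverse. *)
Local Notation letter := (X * bool)%type.

Definition linv (a : letter) : letter := (a.1, ~~ a.2).

Lemma linvK : involutive linv.
Proof. by case=> x b; rewrite /linv /= negbK. Qed.

Definition reduced (u : seq letter) : bool :=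
  sorted (fun a b => b != linv a) u.

Definition lpush (a : letter) (u : seq letter) : seq letter :=
  if u is b :: v then if b == linv a then v else a :: u else [:: a].

Definition lact (u v : seq letter) : seq letter := foldr lpush v u.

Lemma reduced_tail a u : reduced (a :: u) -> reduced u.
Proof. exact: path_sorted. Qed.

Lemma lpush_reduced a u : reduced u -> reduced (lpush a u).
Proof.
case: u => [//|b u] ru /=; case: ifPn => [_|nba]; first exact: reduced_tail ru.
by rewrite /reduced /= nba.
Qed.

Lemma lact_reduced u v : reduced v -> reduced (lact u v).
Proof. by move=> rv; elim: u => //= a u; exact: lpush_reduced. Qed.

Lemma lpushK a u : reduced u -> lpush a (lpush (linv a) u) = u.
Proof.
case: u => [_|b u] /=; first by rewrite eqxx.
rewrite linvK; case: (eqVneq b a) => [->|nba] ru; last by rewrite /= eqxx.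
by case: u ru => [//|c u] /= /andP[/negPf ->].
Qed.

Lemma lact_push a u v : reduced v -> lact (lpush a u) v = lpush a (lact u v).
Proof.
case: u => [//|b u] rv /=; case: eqVneq => //= ->.
by rewrite lpushK //; exact: lact_reduced.
Qed.

Lemma lactA u v w : reduced w -> lact (lact u v) w = lact u (lact v w).
Proof. by move=> rw; elim: u => //= a u IHu; rewrite lact_push// IHu. Qed.

Lemma lact0 u : reduced u -> lact u [::] = u.
Proof.
elim: u => //= a u IHu ru; rewrite IHu ?(reduced_tail ru)//.
by case: u ru {IHu} => //= b u /andP[/negPf->].
Qed.

Definition lrevinv (u : seq letter) : seq letter := rev (map linv u).

Lemma lrevinvK : involutive lrevinv.
Proof.
by move=> u; rewrite /lrevinv map_rev revK -map_comp map_id_in// => a _ /=;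
   exact: linvK.
Qed.

Lemma lrevinv_reduced u : reduced u -> reduced (lrevinv u).
Proof.
rewrite /reduced /lrevinv rev_sorted sorted_map; apply: sub_sorted => a b /=.
by apply: contraNN => /eqP E; rewrite -[b]linvK -E.
Qed.

Lemma lactKV u v : reduced v -> lact (lrevinv u) (lact u v) = v.
Proof.
move=> rv; elim: u => [//|a u IHu].
rewrite /lrevinv /= rev_cons -cats1 /lact foldr_cat /= -/(lact u v).
by rewrite -{2}[a]linvK lpushK ?lact_reduced.
Qed.

Record freegroup := FreeGroup { fgword :> seq letter; _ : reduced fgword }.
HB.instance Definition _ := [isSub for fgword].
HB.instance Definition _ := [Choice of freegroup by <:].

Lemma freegroup_reduced (u : freegroup) : reduced u.
Proof. exact: (valP u). Qed.
Hint Resolve freegroup_reduced : core.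

Definition fgone := @FreeGroup [::] isT.
Definition fgmul (u v : freegroup) :=
  FreeGroup (lact_reduced u (freegroup_reduced v)).
Definition fginv (u : freegroup) :=
  FreeGroup (lrevinv_reduced (freegroup_reduced u)).

Lemma fgmulA : associative fgmul.
Proof. by move=> u v w; apply: val_inj; rewrite /= lactA. Qed.
Lemma fgmul1g : left_id fgone fgmul.
Proof. by move=> u; apply: val_inj. Qed.
Lemma fgmulg1 : right_id fgone fgmul.
Proof. by move=> u; apply: val_inj; rewrite /= lact0. Qed.
Lemma fgmulVg : left_inverse fgone fginv fgmul.
Proof.
move=> u; apply: val_inj => /=.
by rewrite -[X in lact _ X](lact0 (freegroup_reduced u)) lactKV.
Qed.
Lemma fgmulgV : right_inverse fgone fginv fgmul.
Proof.
move=> u; rewrite -[X in fgmul X](_ : fginv (fginv u) = u) ?fgmulVg//.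
by apply: val_inj; rewrite /= lrevinvK.
Qed.

HB.instance Definition _ :=
  isGroup.Build freegroup fgmulA fgmul1g fgmulg1 fgmulVg fgmulgV.

Definition fgvar (x : X) : freegroup := @FreeGroup [:: (x, false)] isT.

Section Lift.
Variables (G : groupType) (f : X -> G).

Definition fglift_letter (a : letter) : G :=
  if a.2 then (f a.1)^-1%g else f a.1.

Definition fglift_word (u : seq letter) : G :=
  (\prod_(a <- u) fglift_letter a)%g.

(* The unique homomorphism extending f: see fglift_var and fglift_uniq. *)
Definition fglift (u : freegroup) : G := fglift_word u.

Lemma fglift_letterV a : fglift_letter (linv a) = (fglift_letter a)^-1%g.
Proof. by case: a => x []; rewrite /fglift_letter /= ?invgK. Qed.

Lemma fglift_word_push a u :
  fglift_word (lpush a u) = (fglift_letter a * fglift_word u)%g.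
Proof.
rewrite /fglift_word; case: u => [|b u] /=; first by rewrite big_seq1 big_nil mulg1.
case: eqVneq => [->|_]; rewrite !big_cons// fglift_letterV.
by rewrite mulgA mulgV mul1g.
Qed.

Lemma fglift_is_morphism : monoid.monoid_morphism fglift.
Proof.
split=> [|u v]; first by rewrite /fglift /fglift_word big_nil.
rewrite /fglift /=; elim: (fgword u) => [|a w IHw] /=.
  by rewrite /fglift_word big_nil mul1g.
by rewrite fglift_word_push IHw mulgA /fglift_word big_cons.
Qed.
HB.instance Definition _ :=
  isUMagmaMorphism.Build freegroup G fglift fglift_is_morphism.

Lemma fglift_var x : fglift (fgvar x) = f x.
Proof. by rewrite /fglift /fglift_word big_seq1. Qed.

Lemma fglift_uniq (h : ghom freegroup G) :
  (forall x, h (fgvar x) = f x) -> forall u, h u = fglift u.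
Proof.
move=> hf [u ru]; rewrite /fglift /=; elim: u ru => [|a u IHu] rau.
  rewrite /fglift_word big_nil; have <- : h 1%g = 1%g := gmulf1.
  by congr (h _); exact: val_inj.
have ra : reduced [:: a] by [].
have -> : FreeGroup rau = (FreeGroup ra * FreeGroup (reduced_tail rau))%g.
  apply: val_inj => /=; have /= := lact0 rau.
  by rewrite lact0// (reduced_tail rau).
rewrite gmulfM IHu /fglift_word big_cons; congr (_ * _)%g.
case: a ra {rau} => x [] ra; rewrite /fglift_letter /= -hf; last first.
  by congr (h _); exact: val_inj.
by rewrite -gmulfV; congr (h _); exact: val_inj.
Qed.

End Lift.
End FreeGroup.

(* A unit is recorded together with its (unique) inverse. *)
Section Units.
Variable A : pzRingType.

Record units := Units {
  unit_val : A;
  unit_inv : A;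
  _ : (unit_val * unit_inv == 1) && (unit_inv * unit_val == 1) }.

HB.instance Definition _ := gen_eqMixin units.
HB.instance Definition _ := gen_choiceMixin units.

Lemma unit_valV u : unit_val u * unit_inv u = 1.
Proof. by case: u => a b /= /andP[/eqP]. Qed.

Lemma unit_Vval u : unit_inv u * unit_val u = 1.
Proof. by case: u => a b /= /andP[_ /eqP]. Qed.

Lemma unit_val_inj : injective unit_val.
Proof.
move=> [a b ab] [a' b' ab'] /= E; subst a'.
have E : b = b'.
  move: (ab) (ab') => /andP[_ /eqP ba] /andP[/eqP ab'' _].
  by rewrite -[b]mulr1 -ab'' mulrA ba mul1r.
by subst b'; congr Units; exact: bool_irrelevance.
Qed.

Fact units_one_subproof : ((1 : A) * 1 == 1) && ((1 : A) * 1 == 1).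
Proof. by rewrite mulr1 eqxx. Qed.
Definition units_one := Units units_one_subproof.

Fact units_mul_subproof u v :
  (unit_val u * unit_val v * (unit_inv v * unit_inv u) == 1) &&
  (unit_inv v * unit_inv u * (unit_val u * unit_val v) == 1).
Proof.
rewrite mulrA -[X in X * _ == 1]mulrA unit_valV mulr1 unit_valV eqxx /=.
by rewrite mulrA -[X in X * _ == 1]mulrA unit_Vval mulr1 unit_Vval.
Qed.
Definition units_mul u v := Units (units_mul_subproof u v).

Fact units_inv_subproof u :
  (unit_inv u * unit_val u == 1) && (unit_val u * unit_inv u == 1).
Proof. by rewrite unit_valV unit_Vval eqxx. Qed.
Definition units_inv u := Units (units_inv_subproof u).

Lemma units_mulA : associative units_mul.
Proof. by move=> u v w; apply: unit_val_inj; rewrite /= mulrA. Qed.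
Lemma units_mul1g : left_id units_one units_mul.
Proof. by move=> u; apply: unit_val_inj; rewrite /= mul1r. Qed.
Lemma units_mulg1 : right_id units_one units_mul.
Proof. by move=> u; apply: unit_val_inj; rewrite /= mulr1. Qed.
Lemma units_mulVg : left_inverse units_one units_inv units_mul.
Proof. by move=> u; apply: unit_val_inj; rewrite /= unit_Vval. Qed.
Lemma units_mulgV : right_inverse units_one units_inv units_mul.
Proof. by move=> u; apply: unit_val_inj; rewrite /= unit_valV. Qed.

HB.instance Definition _ := isGroup.Build units
  units_mulA units_mul1g units_mulg1 units_mulVg units_mulgV.

End Units.

Section Ideals.
Variable A : pzRingType.

Definition is_ideal (I : set A) : Prop :=
  [/\ I 0, (forall a b, I a -> I b -> I (a - b)) &
      (forall c a, I a -> I (c * a) /\ I (a * c))].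

Definition ideal_gen (G : set A) : set A := smallest is_ideal G.

Definition ideal_mul (I J : set A) : set A :=
  ideal_gen [set a * b | a in I & b in J].

Definition ideal_pow (I : set A) (k : nat) : set A :=
  iter k (ideal_mul I) setT.

End Ideals.

Section WordFunctions.
Variables (X : choiceType) (S : comPzRingType).

Definition wordfun : Type := seq X -> S.

HB.instance Definition _ := GRing.Zmodule.copy wordfun (seq X -> S).

Implicit Types f g h : wordfun.

Definition wf_one : wordfun := fun w => (w == [::])%:R.

Definition wf_mul f g : wordfun :=
  fun w => \sum_(k < (size w).+1) f (take k w) * g (drop k w).

Definition wf_shift (a : X) f : wordfun := fun w => f (a :: w).

Lemma wf_mul0 f g : wf_mul f g [::] = f [::] * g [::].
Proof. by rewrite /wf_mul big_ord_recl big_ord0 addr0. Qed.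

Lemma wf_mulS f g a w :
  wf_mul f g (a :: w) = f [::] * g (a :: w) + wf_mul (wf_shift a f) g w.
Proof. by rewrite /wf_mul big_ord_recl. Qed.

Lemma wf_mulDl f g h : wf_mul (f + g) h = wf_mul f h + wf_mul g h.
Proof.
apply/funext => w; rewrite [RHS]/GRing.add /= /wf_mul -big_split /=.
by apply: eq_bigr => k _; rewrite -mulrDl.
Qed.

Lemma wf_mulDr f g h : wf_mul f (g + h) = wf_mul f g + wf_mul f h.
Proof.
apply/funext => w; rewrite [RHS]/GRing.add /= /wf_mul -big_split /=.
by apply: eq_bigr => k _; rewrite -mulrDr.
Qed.

Lemma wf_mulZl (c : S) f g w :
  wf_mul (fun u => c * f u) g w = c * wf_mul f g w.
Proof. by rewrite /wf_mul big_distrr; apply: eq_bigr => k _; rewrite /= mulrA. Qed.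

Lemma wf_mulA : associative wf_mul.
Proof.
move=> f g h; apply/funext => w; elim: w f g h => [|a w IHw] f g h.
  by rewrite !wf_mul0 mulrA.
rewrite !wf_mulS wf_mul0 mulrDr -addrA mulrA; congr (_ + _).
rewrite IHw -wf_mulZl.
have -> : wf_shift a (wf_mul f g) =
    ((fun u => f [::] * wf_shift a g u) : wordfun) + wf_mul (wf_shift a f) g.
  by apply/funext => u; rewrite /wf_shift wf_mulS.
by rewrite wf_mulDl.
Qed.

Lemma wf_mul1r : left_id wf_one wf_mul.
Proof.
move=> f; apply/funext => w; rewrite /wf_mul big_ord_recl take0 drop0 /wf_one mul1r.
rewrite big1 ?addr0// => k _ /=; case: w k => [[]//|a w k] /=.
by rewrite mul0r.
Qed.

Lemma wf_mulr1 : right_id wf_one wf_mul.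
Proof.
move=> f; apply/funext => w; elim: w f => [|a w IHw] f.
  by rewrite wf_mul0 /wf_one mulr1.
by rewrite wf_mulS IHw /wf_one mulr0 add0r.
Qed.

HB.instance Definition _ := GRing.Zmodule_isPzRing.Build wordfun
  wf_mulA wf_mul1r wf_mulr1
  (fun f g h => wf_mulDl f g h) (fun f g h => wf_mulDr f g h).

End WordFunctions.

(* An element of S<<X>> is a family of coefficients indexed by words whose
   degree n part, for every n, lies in the free algebra, i.e., has finitely many
   nonzero coefficients (a genuine condition when X is infinite). *)
Section Series.
Variables (X : choiceType) (S : comPzRingType).

Definition is_ncseries : pred (wordfun X S) := fun f =>
  `[< forall n, finite_set [set w : seq X | size w = n /\ f w <> 0] >].

Record ncseries := NCSeries {
  nccoef :> wordfun X S;
  _ : is_ncseries nccoef }.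
HB.instance Definition _ := [isSub for nccoef].
HB.instance Definition _ := [Choice of ncseries by <:].

Fact ncseries_subring : subring_closed is_ncseries.
Proof.
split=> [|f g /asboolP ff /asboolP fg|f g /asboolP ff /asboolP fg];
  apply/asboolP => n.
- apply: (@sub_finite_set _ _ [set [::]]) => //= w [_].
  rewrite /GRing.one /= /wf_one; case: eqVneq => //.
- apply: (@sub_finite_set _ _ ([set w | size w = n /\ f w <> 0] `|`
                               [set w | size w = n /\ g w <> 0])); last first.
    by rewrite finite_setU; split.
  move=> w /= [sw nz]; have [fw|fw] := eqVneq (f w) 0; last by left; split=> //; apply/eqP.
  right; split=> // gw; apply: nz.
  by rewrite [LHS](_ : _ = f w - g w)// fw gw subr0.
- pose P k := [set u ++ v | u in [set w | size w = k /\ f w <> 0] &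
                            v in [set w | size w = (n - k)%N /\ g w <> 0]].
  apply: (@sub_finite_set _ _ (\bigcup_(k in `I_n.+1) P k)); last first.
    apply: bigcup_finite => // k _; exact: finite_image2.
  move=> w /= [sw nz].
  have [k _ knz] : exists2 k : 'I_((size w).+1), true &
      f (take k w) * g (drop k w) <> 0.
    apply: contrapT => H; apply: nz; rewrite [LHS]/GRing.mul /= /wf_mul big1// => k _.
    by apply: contrapT => kn; apply: H; exists k.
  have ks : (k <= size w)%N by rewrite -ltnS.
  have kn : (k <= n)%N by apply: leq_trans ks _; rewrite sw.
  exists (k : nat) => //=; exists (take k w).
    split; first by rewrite size_takel.
    by move=> E; apply: knz; rewrite E mul0r.
  exists (drop k w); last by rewrite cat_take_drop.
  split; first by rewrite size_drop; congr (_ - _)%N.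
  by move=> E; apply: knz; rewrite E mulr0.
Qed.

HB.instance Definition _ :=
  GRing.SubChoice_isSubPzRing.Build (wordfun X S) is_ncseries ncseries
    ncseries_subring.

Fact ncvar_subproof x : is_ncseries (fun w => (w == [:: x])%:R).
Proof.
apply/asboolP => n; apply: (@sub_finite_set _ _ [set [:: x]]) => //= w [_].
by case: eqVneq.
Qed.
Definition ncvar (x : X) : ncseries := NCSeries (ncvar_subproof x).

Definition ncgeom_fun (x : X) : wordfun X S :=
  fun w => if all (pred1 x) w then (-1) ^+ size w else 0.

Fact ncgeom_subproof x : is_ncseries (ncgeom_fun x).
Proof.
apply/asboolP => n; apply: (@sub_finite_set _ _ [set nseq n x]) => //= w [<-].
by rewrite /ncgeom_fun; case: all_pred1P.
Qed.
Definition ncgeom (x : X) : ncseries := NCSeries (ncgeom_subproof x).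

Fact one_plus_var_unit (x : X) :
  ((1 + ncvar x) * ncgeom x == 1) && (ncgeom x * (1 + ncvar x) == 1).
Proof.
pose v : wordfun X S := fun w => (w == [::])%:R + (w == [:: x])%:R.
have vS a : wf_shift a v = fun w => (a == x)%:R * wf_one S w.
  apply/funext => w; rewrite /wf_shift /v /= add0r /wf_one eqseq_cons.
  by rewrite -natrM mulnb.
have gS a : wf_shift a (ncgeom_fun x) = fun w => - (a == x)%:R * ncgeom_fun x w.
  apply/funext => w; rewrite /wf_shift /ncgeom_fun /=.
  case: eqVneq => _ /=; last by rewrite oppr0 mul0r.
  by case: ifP => _; rewrite ?mulr0// exprS.
apply/andP; split; apply/eqP/val_inj/funext => w.
- rewrite [LHS](_ : _ = wf_mul v (ncgeom_fun x) w)// [RHS](_ : _ = wf_one S w)//.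
  case: w => [|a w]; first by rewrite wf_mul0 /v /ncgeom_fun /wf_one /= addr0 mulr1.
  rewrite wf_mulS vS wf_mulZl [X in _ + _ * X](_ : _ = ncgeom_fun x w); last first.
    exact: (congr1 (@^~ w) (wf_mul1r (ncgeom_fun x))).
  have := congr1 (@^~ w) (gS a); rewrite /wf_shift => ->.
  by rewrite /v /= addr0 mul1r mulNr addNr.
- rewrite [LHS](_ : _ = wf_mul (ncgeom_fun x) v w)// [RHS](_ : _ = wf_one S w)//.
  elim: w => [|a w IHw]; first by rewrite wf_mul0 /v /ncgeom_fun /wf_one /= addr0 mulr1.
  rewrite wf_mulS gS wf_mulZl IHw.
  have := congr1 (@^~ w) (vS a); rewrite /wf_shift => ->.
  by rewrite {1}/ncgeom_fun /= mul1r mulNr addrN.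
Qed.

Definition one_plus_var (x : X) : units ncseries := Units (one_plus_var_unit x).

Definition magnus : freegroup X -> units ncseries := fglift one_plus_var.
HB.instance Definition _ := UMagmaMorphism.on magnus.

Lemma magnus_var x : unit_val (magnus (fgvar x)) = 1 + ncvar x.
Proof. by rewrite /magnus fglift_var. Qed.

Definition magnus_coef (w : seq X) (g : freegroup X) : S :=
  nccoef (unit_val (magnus g)) w.

Lemma magnus_coef1 w : magnus_coef w 1%g = (w == [::])%:R.
Proof. by rewrite /magnus_coef gmulf1. Qed.

Lemma magnus_coefM w g h :
  magnus_coef w (g * h)%g =
  \sum_(k < (size w).+1) magnus_coef (take k w) g * magnus_coef (drop k w) h.
Proof. by rewrite /magnus_coef gmulfM. Qed.

Lemma magnus_coef0 g : magnus_coef [::] g = 1.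
Proof.
case: g => u ru; rewrite /magnus_coef /magnus /fglift /=.
elim: u {ru} => [|a u IHu]; first by rewrite /fglift_word big_nil.
rewrite /fglift_word big_cons [LHS](_ : _ =
  wf_mul (unit_val (fglift_letter one_plus_var a))
         (unit_val (fglift_word one_plus_var u)) [::])//.
rewrite wf_mul0 IHu mulr1; case: a => x [] //=.
by rewrite [LHS](_ : _ = 1 + 0)// addr0.
Qed.

Definition aug_ideal : set ncseries := ideal_gen (range ncvar).

Definition aug_filtration (e : nat -> nat -> nat) (n : nat) : set ncseries :=
  [set \sum_(1 <= i < n.+1) a i *+ e n i |
     a in [set a : nat -> ncseries |
             forall i, (1 <= i <= n)%N -> ideal_pow aug_ideal i (a i)]].

End Series.

Arguments ncvar {X} S x.
Arguments magnus {X} S g.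
Arguments magnus_coef {X} S w g.
Arguments aug_ideal : clear implicits.
Arguments aug_filtration : clear implicits.

Section UT.
Variables (S : comPzRingType) (n : nat).

Definition unitriangular : pred 'M[S]_n := fun A =>
  [forall i : 'I_n, forall j : 'I_n, (j <= i)%N ==> (A i j == (i == j)%:R)].

Lemma unitriangularP (A : 'M[S]_n) :
  reflect (forall i j : 'I_n, (j <= i)%N -> A i j = (i == j)%:R)
          (unitriangular A).
Proof.
apply: (iffP forallP) => H i; last first.
  by apply/forallP => j; apply/implyP => ji; rewrite H.
by move=> j ji; apply/eqP; move/forallP/(_ j)/implyP: (H i); apply.
Qed.

Record UT := UTMatrix { utmx :> 'M[S]_n; _ : unitriangular utmx }.
HB.instance Definition _ := [isSub for utmx].
HB.instance Definition _ := [Choice of UT by <:].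

Fact ut1_subproof : unitriangular 1%:M.
Proof. by apply/unitriangularP => i j _; rewrite mxE. Qed.
Definition ut1 := UTMatrix ut1_subproof.

Fact utmul_subproof (A B : UT) : unitriangular (utmx A *m utmx B).
Proof.
have /unitriangularP hA := valP A; have /unitriangularP hB := valP B.
apply/unitriangularP => i j ji; rewrite mxE (bigD1 i)//= big1 => [|k ki].
  by rewrite [utmx A _ _]hA// eqxx mul1r addr0 [utmx B _ _]hB.
have [kl|ik] := ltnP k i.
  by rewrite [utmx A _ _]hA ?(ltnW kl)// eq_sym (negPf ki) mul0r.
rewrite [utmx B _ _]hB ?(leq_trans ji ik)//; case: eqVneq => [kj|]; last by rewrite mulr0.
by case/eqP: ki; apply/val_inj/eqP; rewrite eqn_leq ik kj ji.
Qed.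
Definition utmul A B := UTMatrix (utmul_subproof A B).

Lemma strict_upperX (N : 'M[S]_n) :
  (forall i j : 'I_n, (j <= i)%N -> N i j = 0) ->
  forall k (i j : 'I_n), (j < i + k)%N -> (N ^+ k) i j = 0.
Proof.
move=> hN; elim=> [|k IHk] i j.
  by rewrite addn0 => ji; rewrite expr0 mxE; case: eqVneq ji => // ->; rewrite ltnn.
move=> jik; rewrite exprS mxE big1// => l _.
have [li|il] := leqP l i; first by rewrite hN// mul0r.
rewrite IHk ?mulr0//; apply: leq_trans jik _.
by rewrite addnS -addSn leq_add2r.
Qed.

Definition utinv_mx (A : 'M[S]_n) : 'M[S]_n := \sum_(k < n) (1 - A) ^+ k.

Lemma strict_upper_sub1 (A : UT) (i j : 'I_n) :
  (j <= i)%N -> (1 - utmx A) i j = 0.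
Proof.
have /unitriangularP hA := valP A.
by move=> ji; rewrite !mxE [utmx A i j]hA// subrr.
Qed.

Lemma sub1_nilp (A : UT) : (1 - utmx A) ^+ n = 0.
Proof.
apply/matrixP => i j; rewrite [RHS]mxE strict_upperX//.
  exact: strict_upper_sub1.
by rewrite (leq_trans (ltn_ord j))// leq_addl.
Qed.

Lemma utmx_mulV (A : UT) : utmx A * utinv_mx A = 1.
Proof.
have := subrX1 (1 - utmx A) n; rewrite sub1_nilp addrAC subrr sub0r sub0r mulNr.
by move=> /oppr_inj ->.
Qed.

Lemma utmx_Vmul (A : UT) : utinv_mx A * utmx A = 1.
Proof.
rewrite -[RHS](utmx_mulV A) /utinv_mx; apply/esym/commr_sum => k _.
apply/commrX; rewrite /GRing.comm mulrBr mulrBl mulr1 mul1r //.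
Qed.

Fact utinv_subproof (A : UT) : unitriangular (utinv_mx A).
Proof.
apply/unitriangularP => i j ji; rewrite /utinv_mx.
have n0 : (0 < n)%N by case: (n) i {j ji} => [[]|].
rewrite summxE (bigD1 (Ordinal n0))//= big1 => [|k k0]; last first.
  apply: strict_upperX => [|]; first exact: strict_upper_sub1.
  rewrite (leq_ltn_trans ji)// -[X in (X < _)%N]addn0 ltn_add2l lt0n.
  by apply: contraNneq k0 => k0; apply/eqP/val_inj.
by rewrite addr0 expr0 mxE.
Qed.
Definition utinv (A : UT) := UTMatrix (utinv_subproof A).

Lemma utmulA : associative utmul.
Proof. by move=> A B C; apply: val_inj; rewrite /= mulmxA. Qed.
Lemma utmul1g : left_id ut1 utmul.
Proof. by move=> A; apply: val_inj; rewrite /= mul1mx. Qed.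
Lemma utmulg1 : right_id ut1 utmul.
Proof. by move=> A; apply: val_inj; rewrite /= mulmx1. Qed.
Lemma utmulVg : left_inverse ut1 utinv utmul.
Proof. by move=> A; apply: val_inj; exact: utmx_Vmul. Qed.
Lemma utmulgV : right_inverse ut1 utinv utmul.
Proof. by move=> A; apply: val_inj; exact: utmx_mulV. Qed.

HB.instance Definition _ :=
  isGroup.Build UT utmulA utmul1g utmulg1 utmulVg utmulgV.

End UT.

Section MagnusRep.
Variables (X : choiceType) (S : comPzRingType) (w : seq X).

(* With indices starting at 0, the word attached to the entry (i, j), i < j, is
   the factor of w occupying the positions i, ..., j - 1. *)
Definition magnus_mx (g : freegroup X) : 'M[S]_((size w).+1) :=
  \matrix_(i, j) if (i < j)%N then magnus_coef S (drop i (take j w)) g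
                 else (i == j)%:R.

Fact magnus_mx_ut g : unitriangular (magnus_mx g).
Proof. by apply/unitriangularP => i j ji; rewrite mxE ltnNge ji. Qed.

Definition magnus_rep (g : freegroup X) : UT S (size w).+1 :=
  UTMatrix (magnus_mx_ut g).

Lemma magnus_mxE g (i j : 'I_((size w).+1)) : (i <= j)%N ->
  magnus_mx g i j = magnus_coef S (drop i (take j w)) g.
Proof.
rewrite mxE leq_eqVlt => /predU1P[ij|->]//; rewrite -ij ltnn.
have -> : i = j by exact: val_inj.
by rewrite eqxx drop_oversize ?magnus_coef0// size_takel// -ltnS.
Qed.

Fact magnus_rep_is_morphism : monoid.monoid_morphism magnus_rep.
Proof.
split=> [|g h]; apply/val_inj/matrixP => i j.
  rewrite !mxE; case: ltnP => // ij; rewrite magnus_coef1.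
  have sj : (j <= size w)%N by rewrite -ltnS.
  rewrite -size_eq0 size_drop size_takel// subn_eq0 leqNgt ij.
  by case: eqVneq ij => // ->; rewrite ltnn.
have [ij|ji] := leqP i j; last first.
  have /unitriangularP h1 := magnus_mx_ut (g * h)%g.
  have /unitriangularP h2 := valP (magnus_rep g * magnus_rep h)%g.
  by rewrite [LHS]h1 ?(ltnW ji)// [RHS]h2// ltnW.
rewrite [LHS]magnus_mxE// [RHS]mxE magnus_coefM.
have sj : (j <= size w)%N by rewrite -ltnS.
rewrite size_drop size_takel// -(big_mkord xpredT (fun k =>
  magnus_coef S (take k (drop i (take j w))) g *
  magnus_coef S (drop k (drop i (take j w))) h)).
pose F k := (if (i <= k <= j)%N then magnus_coef S (drop i (take k w)) g *
                                 magnus_coef S (drop k (take j w)) h else 0).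
rewrite (eq_bigr (fun k : 'I__ => F k)) => [|k _]; last first.
  rewrite /F; have [ik|ki] /= := leqP i k; last first.
    have /unitriangularP h1 := magnus_mx_ut g.
    rewrite [X in X * _]h1 ?(ltnW ki)//; case: eqVneq ki => [->|]; rewrite ?ltnn ?mul0r//.
  have [kj|jk] := leqP k j; first by rewrite !magnus_mxE.
  have /unitriangularP h1 := magnus_mx_ut h.
  rewrite [X in _ * X]h1 ?(ltnW jk)//; case: eqVneq jk => [->|]; rewrite ?ltnn ?mulr0//.
rewrite -(big_mkord xpredT F) (big_cat_nat _ (n := i) (p := (size w).+1))//=;
  last by apply: leq_trans ij _; exact: leqW.
apply: esym; rewrite big_nat_cond big1 ?add0r => [|k]; last first.
  by rewrite andbT /F => /andP[_ ki]; rewrite leqNgt ki.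
rewrite (big_cat_nat _ (n := j.+1))//=; last exact: leqW.
rewrite [X in _ + X]big_nat_cond [X in _ + X]big1 ?addr0 => [|k]; last first.
  by rewrite andbT /F => /andP[jk _]; rewrite [(k <= j)%N]leqNgt jk andbF.
rewrite -{1}[i : nat]add0n big_addn subSn// big_nat [RHS]big_nat.
apply: eq_bigr => k /= kij.
have kj : (k + i <= j)%N by move: kij; rewrite ltnS leq_subRL// addnC.
rewrite /F leq_addl kj drop_drop; congr (magnus_coef _ _ _ * _).
by rewrite take_drop take_takel.
Qed.
HB.instance Definition _ := isUMagmaMorphism.Build
  (freegroup X) (UT S (size w).+1) magnus_rep magnus_rep_is_morphism.

End MagnusRep.

Arguments magnus_rep {X} S w g.

(* Quotient by an ideal is provided by ring_quotient only for proper ideals;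
   here mR may be all of R, whence the commutative ring structure below, on the
   quotient group. *)
Section QuotientByNat.
Variables (R : comPzRingType) (m : nat).

Definition multiples : {pred R} := fun x : R => `[< exists y, x = y *+ m >].

Fact multiples_zmod_closed : zmod_closed multiples.
Proof.
split; first by apply/asboolP; exists 0; rewrite mul0rn.
move=> x y /asboolP[a ->] /asboolP[b ->]; apply/asboolP.
by exists (a - b); rewrite mulrnBl.
Qed.
HB.instance Definition _ := GRing.isZmodClosed.Build R multiples
  multiples_zmod_closed.

Fact multiplesMl a x : x \in multiples -> a * x \in multiples.
Proof. by move=> /asboolP[y ->]; apply/asboolP; exists (a * y); rewrite mulrnAr. Qed.

Definition modnat : Type := @Quotient.quot R multiples.
HB.instance Definition _ := GRing.Zmodule.on modnat.
HB.instance Definition _ := EqQuotient.on modnat.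

Local Open Scope quotient_scope.

Definition modnat_pi (x : R) : modnat := \pi_modnat x.
Definition modnat_one : modnat := modnat_pi 1.
Definition modnat_mul (x y : modnat) : modnat := modnat_pi (repr x * repr y).

Lemma modnat_piK (x : modnat) : modnat_pi (repr x) = x.
Proof. exact: reprK. Qed.

Lemma modnat_piP x y : reflect (modnat_pi x = modnat_pi y) (x - y \in multiples).
Proof. by rewrite (Quotient.idealrBE multiples); exact: eqP. Qed.

Lemma modnat_piM x y : modnat_pi (x * y) = modnat_mul (modnat_pi x) (modnat_pi y).
Proof.
apply/modnat_piP.
set x' := repr _; set y' := repr _.
have hx : x - x' \in multiples by apply/modnat_piP; rewrite modnat_piK.
have hy : y - y' \in multiples by apply/modnat_piP; rewrite modnat_piK.
have -> : x * y - x' * y' = y * (x - x') + x' * (y - y').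
  by rewrite !mulrBr [y * x]mulrC [y * x']mulrC addrA subrK.
by rewrite rpredD ?multiplesMl.
Qed.

Lemma modnat_piD : {morph modnat_pi : x y / x + y}.
Proof. exact: (@Quotient.pi_add R multiples). Qed.

Lemma modnat_mulA : associative modnat_mul.
Proof.
move=> x y z; rewrite -[x]modnat_piK -[y]modnat_piK -[z]modnat_piK.
by rewrite -!modnat_piM mulrA.
Qed.
Lemma modnat_mulC : commutative modnat_mul.
Proof. by move=> x y; rewrite /modnat_mul mulrC. Qed.
Lemma modnat_mul1 : left_id modnat_one modnat_mul.
Proof. by move=> x; rewrite -[x]modnat_piK -modnat_piM mul1r. Qed.
Lemma modnat_mulDl : left_distributive modnat_mul +%R.
Proof.
move=> x y z; rewrite -[x]modnat_piK -[y]modnat_piK -[z]modnat_piK.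
by rewrite -modnat_piD -!modnat_piM mulrDl modnat_piD.
Qed.

HB.instance Definition _ := GRing.Zmodule_isComPzRing.Build modnat
  modnat_mulA modnat_mulC modnat_mul1 modnat_mulDl.

End QuotientByNat.

(* Main.v *)
Require Import Defs.
From HB Require Import structures.
From mathcomp Require Import all_boot all_algebra.
From mathcomp Require Import boolp classical_sets cardinality.

Set Implicit Arguments.
Unset Strict Implicit.
Unset Printing Implicit Defensive.

Import GRing.Theory.

Local Open Scope ring_scope.
Local Open Scope classical_set_scope.

(** All three subgroups are cut out by conditions on the Magnus coefficients:
    each consists of the g such that, for every word w with 0 < |w| < n, the
    coefficient of w in the expansion of g over R is a multiple of e(n, |w|).

    For the filtration (aug_filtrationP), elements of the i-th power of the ideal
    generated by X have order at least i, and e(n, d) divides e(n, i) for i <= d;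
    conversely the expansion of g involves finitely many variables, so its part
    of order at least i lies in the i-th power of the ideal
    (ideal_pow_over_alphabet), and dividing the homogeneous part of degree i by
    e(n, i) gives the required decomposition.

    For the representations phi_w, Magnus coefficients are compatible with
    reduction from R to R / m R (magnus_coef_map), and every nonempty word of
    length at most d is a factor of a word of length d (magnus_rep_ker_coef).
    Hence the intersection of the kernels for a given d asks that the coefficient
    of every word w with 0 < |w| <= d be a multiple of e(n, d). The strongest of
    these conditions on w is that for d = |w|, again by divisibility.

    Finally, any homomorphism phi from F to unitriangular matrices of size d + 1
    is obtained from the Magnus expansion by substituting phi(x) - 1 for x
    (magnus_mxeval). These matrices are strictly upper triangular, so words longer
    than d contribute nothing, and phi(g) = 1 as soon as the coefficients of
    lengths 1 to d vanish (hom_ut_eq1). So for each d the kernels of all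
    homomorphisms have the same intersection as those of the phi_w. *)

Lemma freegroup_ind (X : choiceType) (P : freegroup X -> Prop) :
  P 1%g ->
  (forall x g, P g -> P (fgvar x * g)%g) ->
  (forall x g, P g -> P ((fgvar x)^-1 * g)%g) ->
  forall g, P g.
Proof.
move=> P1 PM PV g.
have -> : g = fglift (@fgvar X) g.
  pose idF : ghom (freegroup X) (freegroup X) := idfun.
  exact: (fglift_uniq (h := idF)).
rewrite /fglift; elim: (fgword g) => [|[x []] u IHu].
- by rewrite /fglift_word big_nil.
- by rewrite /fglift_word big_cons; exact: PV.
- by rewrite /fglift_word big_cons; exact: PM.
Qed.

(** * Magnus coefficients *)

Section Coefficients.
Variable X : choiceType.

Section OneRing.
Variable S : comPzRingType.
Implicit Types (g : freegroup X) (f : ncseries X S).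

Lemma ncseriesP f (h : ncseries X S) : nccoef f =1 nccoef h -> f = h.
Proof. by move=> fh; apply/val_inj/funext. Qed.

Lemma coef_sum (T : Type) (r : seq T) (P : pred T) (F : T -> ncseries X S) w :
  nccoef (\sum_(t <- r | P t) F t) w = \sum_(t <- r | P t) nccoef (F t) w.
Proof. exact: (big_morph (fun f => nccoef f w)). Qed.

Lemma coef_muln f k w : nccoef (f *+ k) w = nccoef f w *+ k.
Proof. by elim: k => // k IHk; rewrite !mulrS -IHk. Qed.

Lemma coefM f (h : ncseries X S) w :
  nccoef (f * h) w =
  \sum_(k < (size w).+1) nccoef f (take k w) * nccoef h (drop k w).
Proof. by []. Qed.

Lemma coef_ncvarM x f w :
  nccoef (ncvar S x * f) w =
  if w is a :: v then (a == x)%:R * nccoef f v else 0.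
Proof.
rewrite coefM; case: w => [|a v] /=.
  by rewrite big_ord_recl big_ord0 /= mul0r addr0.
rewrite big_ord_recl /= mul0r add0r big_ord_recl /= take0 drop0.
rewrite eqseq_cons eqxx andbT big1 ?addr0// => i _; rewrite eqseq_cons.
by case: v i => [[]|b v i] //=; rewrite andbF mul0r.
Qed.

Lemma coef_varM x f w :
  nccoef ((1 + ncvar S x) * f) w =
  nccoef f w + (if w is a :: v then (a == x)%:R * nccoef f v else 0).
Proof. by rewrite mulrDl mul1r -coef_ncvarM. Qed.

Definition over_alphabet (Y : seq X) f :=
  forall w, ~~ all (mem Y) w -> nccoef f w = 0.

Lemma magnusM g (h : freegroup X) :
  unit_val (magnus S (g * h)%g) = unit_val (magnus S g) * unit_val (magnus S h).
Proof. by rewrite gmulfM. Qed.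

(** The inverse of 1 + x is an infinite geometric series; this form only ever
    multiplies by 1 + x, so that coefficients for x^-1 g are obtained by solving
    for them, by induction on the word. *)
Lemma magnus_varVM x g :
  unit_val (magnus S g) =
  (1 + ncvar S x) * unit_val (magnus S ((fgvar x)^-1 * g)%g).
Proof. by rewrite -magnus_var -magnusM mulgA mulgV mul1g. Qed.

(** Multiplying by 1 + x, or by its inverse, brings in no letter besides x. *)
Lemma magnus_finite_alphabet g :
  exists Y, over_alphabet Y (unit_val (magnus S g)).
Proof.
elim/freegroup_ind: g => [|x g [Y HY]|x g [Y HY]].
- exists [::] => -[//|a v] _; exact: magnus_coef1.
- exists (x :: Y) => w Hw; rewrite magnusM magnus_var coef_varM.
  have mono v : ~~ all (mem (x :: Y)) v -> ~~ all (mem Y) v.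
    by apply: contra; apply: sub_all => a /= aY; rewrite inE aY orbT.
  rewrite [X in X + _]HY ?mono// add0r.
  case: w Hw => // a v; rewrite /= negb_and inE negb_or.
  case/orP=> [/andP[/negPf -> _]|Hv]; first by rewrite mul0r.
  by rewrite [X in _ * X]HY ?mulr0 ?mono.
- exists (x :: Y) => w; elim: w => // a v IHv Hw.
  have Hw' : ~~ all (mem Y) (a :: v).
    by apply: contra Hw; apply: sub_all => b /= bY; rewrite inE bY orbT.
  have := HY _ Hw'; rewrite (magnus_varVM x) coef_varM.
  rewrite [X in _ + X](_ : _ = 0) ?addr0//.
  move: Hw; rewrite /= negb_and inE negb_or.
  case/orP=> [/andP[/negPf -> _]|Hv]; first by rewrite mul0r.
  by rewrite [X in _ * X]IHv ?mulr0.
Qed.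

End OneRing.

Lemma magnus_coef_map (R S : comPzRingType) (p : {rmorphism R -> S})
    (g : freegroup X) w :
  magnus_coef S w g = p (magnus_coef R w g).
Proof.
elim/freegroup_ind: g w => [|x g IHg|x g IHg] w.
- by rewrite !magnus_coef1 rmorph_nat.
- rewrite /magnus_coef !magnusM !magnus_var !coef_varM rmorphD.
  congr (_ + _); first exact: IHg.
  case: w => [|a v]; first by rewrite rmorph0.
  by rewrite rmorphM rmorph_nat; congr (_ * _); exact: IHg.
- elim: w => [|a v IHv]; first by rewrite !magnus_coef0 rmorph1.
  have := IHg (a :: v); rewrite /magnus_coef.
  rewrite (magnus_varVM S x) (magnus_varVM R x) !coef_varM rmorphD.
  rewrite rmorphM rmorph_nat [X in _ + _ * X]IHv.
  exact: addIr.
Qed.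

End Coefficients.

(** * Reduction of coefficients modulo an integer *)

Section ModnatMorphism.
Variables (R : comPzRingType) (m : nat).

Fact modnat_pi_is_zmod_morphism : zmod_morphism (@modnat_pi R m).
Proof.
by move=> x y; apply: (addIr (modnat_pi m y)); rewrite -modnat_piD !subrK.
Qed.
HB.instance Definition _ := GRing.isZmodMorphism.Build R (modnat R m)
  (@modnat_pi R m) modnat_pi_is_zmod_morphism.

Fact modnat_pi_is_monoid_morphism : monoid_morphism (@modnat_pi R m).
Proof. by split=> // x y; exact: modnat_piM. Qed.
HB.instance Definition _ := GRing.isMonoidMorphism.Build R (modnat R m)
  (@modnat_pi R m) modnat_pi_is_monoid_morphism.

Lemma modnat_pi_eq0 (x : R) : (modnat_pi m x = 0) <-> x \in multiples m.
Proof.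
rewrite -(rmorph0 (modnat_pi m)) -[x in x \in _]subr0.
by split=> /modnat_piP.
Qed.

End ModnatMorphism.

Lemma multiples_dvdn (R : comPzRingType) m k (x : R) :
  (m %| k)%N -> x \in multiples k -> x \in multiples m.
Proof.
move=> /dvdnP[c ->] /asboolP[y ->]; apply/asboolP.
by exists (y *+ c); rewrite mulrnA.
Qed.

Lemma magnus_coef_modnat (X : choiceType) (R : comPzRingType) m w
    (g : freegroup X) :
  magnus_coef (modnat R m) w g = 0 <-> magnus_coef R w g \in multiples m.
Proof. by rewrite (magnus_coef_map (@modnat_pi R m)); exact: modnat_pi_eq0. Qed.

(** * The filtration in terms of coefficients *)

Section Ideals.
Variable A : pzRingType.

Lemma ideal_gen_is_ideal (G : set A) : is_ideal (ideal_gen G).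
Proof.
split.
- by move=> I [[I0 _ _] _].
- move=> a b Ia Ib I HI; have [[_ IB _] _] := HI.
  by apply: IB; [exact: Ia|exact: Ib].
- move=> c a Ia; split=> I HI; have [[_ _ IM] _] := HI.
    by have [] := IM c a (Ia I HI).
  by have [] := IM c a (Ia I HI).
Qed.

Lemma ideal_sum (I : set A) (T : Type) (r : seq T) (F : T -> A) :
  is_ideal I -> (forall t, I (F t)) -> I (\sum_(t <- r) F t).
Proof.
move=> [I0 IB _] IF; apply: big_ind => // a b Ia Ib.
by rewrite -[b]opprK -[- b]sub0r; apply: (IB) => //; exact: IB.
Qed.

End Ideals.

Lemma mult_descending_dvdn e n i j : mult_descending e ->
  (0 < i <= j)%N -> (j <= n)%N -> (e n j %| e n i)%N.
Proof.
move=> [_ eS] /andP[i0]; elim: j => [|j IHj]; first by rewrite leqn0 => /eqP ->.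
rewrite leq_eqVlt => /predU1P[->//|ij jn].
by apply: dvdn_trans (IHj ij (ltnW jn)); apply: eS; rewrite (leq_trans i0).
Qed.

Section Filtration.
Variables (X : choiceType) (R : comPzRingType).
Implicit Types (f : ncseries X R) (Y : seq X).

(** Series of order at least j form an ideal, and orders add up in products. *)
Lemma ideal_pow_coef k f w :
  ideal_pow (aug_ideal X R) k f -> (size w < k)%N -> nccoef f w = 0.
Proof.
elim: k f w => [//|k IHk] f w If.
pose V : set (ncseries X R) :=
  [set h | forall u, (size u < k.+1)%N -> nccoef h u = 0].
suff: V f by apply.
have VI j : is_ideal
    [set h : ncseries X R | forall u, (size u < j)%N -> nccoef h u = 0].
  split=> [u _ //|a b Ha Hb u ul|c a Ha].
    by rewrite [LHS](_ : _ = nccoef a u - nccoef b u)// Ha// Hb// subr0.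
  split=> u ul; rewrite coefM big1// => i _.
    by rewrite [X in _ * X]Ha ?mulr0// size_drop (leq_ltn_trans (leq_subr _ _)).
  by rewrite Ha ?mul0r// size_take_min (leq_ltn_trans (geq_minr _ _)).
apply: If; split=> [|_ [a Ia [b Ib <-]]]; first exact: VI.
have a0 : nccoef a [::] = 0.
  apply: (Ia _ (conj (VI 1%N) _)) => // _ [x _ <-] u.
  by case: u.
move=> [|y u] ul; rewrite coefM big_ord_recl /= a0 mul0r add0r.
  by rewrite big_ord0.
rewrite big1// => i _; rewrite [X in _ * X]IHk ?mulr0// size_drop.
by rewrite (leq_ltn_trans (leq_subr _ _)).
Qed.

Fact ncshift_subproof y f : is_ncseries (wf_shift y (nccoef f)).
Proof.
have /asboolP Hf := valP f; apply/asboolP => n.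
apply: (@sub_finite_set _ _ [set behead w | w in
  [set w | size w = n.+1 /\ nccoef f w <> 0]]); last exact: finite_image.
by move=> w [sw nz]; exists (y :: w) => //; split=> //=; rewrite sw.
Qed.
Definition ncshift y f := NCSeries (ncshift_subproof y f).

Lemma ncshift_sum Y f : uniq Y -> over_alphabet Y f -> nccoef f [::] = 0 ->
  f = \sum_(y <- Y) ncvar R y * ncshift y f.
Proof.
move=> uY Yf f0; apply: ncseriesP => w; rewrite coef_sum.
under eq_bigr do rewrite coef_ncvarM.
case: w => [|a v]; first by rewrite big1.
have [aY|aY] := boolP (a \in Y); last first.
  rewrite [LHS]Yf /= ?(negPf aY)// big_seq big1// => y yY.
  by case: eqVneq aY => [->|]; rewrite ?yY// mul0r.
rewrite (bigD1_seq a)//= eqxx mul1r big1 ?addr0// => y.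
by rewrite eq_sym => /negPf ->; rewrite mul0r.
Qed.

(** Peeling off first letters writes a series of order k as a sum, over words u
    of length k in the alphabet, of u times a series. When X is infinite the sum
    must be finite to lie in the ideal power, which is what the finite alphabet
    ensures: a series like x_1 + x_2 ^+ 2 + x_3 ^+ 3 + ... in distinct variables
    has order 1 but need not belong to the ideal generated by X. *)
Lemma ideal_pow_over_alphabet Y k f : over_alphabet Y f ->
  (forall w, (size w < k)%N -> nccoef f w = 0) ->
  ideal_pow (aug_ideal X R) k f.
Proof.
move=> Yf; have {Yf} : over_alphabet (undup Y) f.
  move=> w Hw; apply: Yf; apply: contra Hw; apply: sub_all => a.
  by rewrite /= mem_undup.
have := undup_uniq Y; move: (undup Y) => {}Y uY.
elim: k f => [//|k IHk] f Yf fk; rewrite (ncshift_sum uY Yf) ?fk//.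
apply: (@ideal_sum _ (ideal_mul _ _)) => [|y]; first exact: ideal_gen_is_ideal.
move=> I [_]; apply; exists (ncvar R y); first by move=> J [_]; apply; exists y.
exists (ncshift y f) => //; apply: IHk => w Hw; last exact: fk.
by apply: Yf; rewrite /= (negPf Hw) andbF.
Qed.

(** In a sum of terms e(n, i) a_i, only the i up to d contribute to degree d,
    and e(n, d) divides all these e(n, i). Conversely, a_i can be taken to be
    the quotient by e(n, i) of the homogeneous part of degree i for i < n, and
    a_n, of multiplier e(n, n) = 1, collects all degrees from n on. *)
Lemma aug_filtrationP e n Y f : mult_descending e -> (0 < n)%N ->
  over_alphabet Y f -> nccoef f [::] = 0 ->
  aug_filtration X R e n f <->
  forall w, (0 < size w < n)%N -> nccoef f w \in multiples (e n (size w)).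
Proof.
move=> he n0 Yf f0; split=> [[a Ha <-] w /andP[w0 wn]|Hf].
  rewrite coef_sum big_nat; apply: rpred_sum => i /andP[i0 ni].
  have [wi|iw] := ltnP (size w) i.
    by rewrite coef_muln (ideal_pow_coef (Ha i _) wi) ?i0// mul0rn rpred0.
  apply: (@multiples_dvdn _ _ (e n i)).
    by apply: mult_descending_dvdn => //; [rewrite i0|exact: ltnW].
  by apply/asboolP; exists (nccoef (a i) w); rewrite coef_muln.
(* The term to which a word w contributes has index minn n (size w). *)
have div w : exists r, w != [::] -> nccoef f w = r *+ e n (minn n (size w)).
  have [->|w0] := eqVneq w [::]; first by exists 0.
  have [nw|wn] := leqP n (size w).
    by exists (nccoef f w); rewrite he.1// mulr1n.
  have /Hf/asboolP[r Hr] : (0 < size w < n)%N by rewrite wn lt0n size_eq0 w0.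
  by exists r.
pose q w := projT1 (cid (div w)).
have qP w : w != [::] -> nccoef f w = q w *+ e n (minn n (size w)).
  exact: projT2 (cid (div w)).
pose b i : wordfun X R :=
  fun w => if (nccoef f w != 0) && (minn n (size w) == i) then q w else 0.
have bP i : is_ncseries (b i).
  have /asboolP Hfin := valP f; apply/asboolP => k.
  apply: sub_finite_set (Hfin k) => w [sw nz]; split=> // fw.
  by apply: nz; rewrite /b fw eqxx.
exists (fun i => NCSeries (bP i)) => [i /andP[i0 ni]|].
  apply: (@ideal_pow_over_alphabet Y) => w Hw; rewrite /= /b.
    by rewrite Yf ?eqxx.
  have [iw|_] := eqVneq (minn n (size w)) i; last by rewrite andbF.
  by move: Hw; rewrite -iw ltnNge geq_minr.
apply: ncseriesP => w; rewrite coef_sum.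
under eq_bigr do rewrite coef_muln /= /b.
have [->|w0] := eqVneq w [::].
  by rewrite f0 eqxx big1 // => i _; rewrite mul0rn.
have [fw|_] := eqVneq (nccoef f w) 0.
  by rewrite fw big1// => i _; rewrite mul0rn.
rewrite qP// (bigD1_seq (minn n (size w))) ?iota_uniq//=; last first.
  by rewrite mem_index_iota ltnS geq_minl andbT leq_min n0 lt0n size_eq0.
rewrite eqxx big1 ?addr0// => i; rewrite eq_sym => /negPf ->.
by rewrite mul0rn.
Qed.

Lemma magnus_aug_filtrationP e n (g : freegroup X) :
  mult_descending e -> (0 < n)%N ->
  [set 1 + a | a in aug_filtration X R e n] (unit_val (magnus R g)) <->
  forall w, (0 < size w < n)%N ->
    magnus_coef R w g \in multiples (e n (size w)).
Proof.
move=> he n0; have [Y HY] := magnus_finite_alphabet R g.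
pose f := unit_val (magnus R g) - 1.
have fE w : w != [::] -> nccoef f w = magnus_coef R w g.
  move=> w0; rewrite [LHS](_ : _ = magnus_coef R w g - (w == [::])%:R)//.
  by rewrite (negPf w0) subr0.
have f0 : nccoef f [::] = 0.
  by rewrite [LHS](_ : _ = magnus_coef R [::] g - 1)// magnus_coef0 subrr.
have Yf : over_alphabet Y f.
  move=> w Hw; rewrite fE; first exact: HY.
  by apply: contraNneq Hw => ->.
have -> : [set 1 + a | a in aug_filtration X R e n] (unit_val (magnus R g))
    <-> aug_filtration X R e n f.
  split=> [[a Ha aE]|Hf]; first by rewrite /f -aE addrC addKr.
  by exists f => //; rewrite /f addrC subrK.
have w_neq0 w : (0 < size w < n)%N -> w != [::] by case: w.
rewrite (aug_filtrationP he n0 Yf f0).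
by split=> H w wn; move: (H w wn); rewrite fE ?w_neq0.
Qed.

End Filtration.

(** * Evaluation of series at nilpotent matrices *)

Section Evaluation.
Variables (X : choiceType) (S : comPzRingType).
Implicit Types f h : wordfun X S.

Section MatrixEvaluation.
Variables (n : nat) (N : X -> 'M[S]_n) (Y : seq X).

(** For Y without repetition, the sum of f(w) N_w over the words w of length at
    most k in the alphabet Y, where N_w is the product of the N y over the letters
    y of w: the value at N of f truncated above degree k. *)
Fixpoint mxeval k f : 'M[S]_n :=
  (f [::])%:M +
  if k is k'.+1 then \sum_(y <- Y) N y *m mxeval k' (wf_shift y f) else 0.

Lemma eq_mxeval k f h :
  (forall w, (size w <= k)%N -> f w = h w) -> mxeval k f = mxeval k h.
Proof.
elim: k f h => [|k IHk] f h fh /=; rewrite fh//; congr (_ + _).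
by apply: eq_bigr => y _; congr (_ *m _); apply: IHk => w wk; exact: fh.
Qed.

Lemma mxeval_axpy k (c : S) f h :
  mxeval k (fun w => f w + c * h w) = mxeval k f + c *: mxeval k h.
Proof.
elim: k f h => [|k IHk] f h /=.
  by rewrite !addr0 raddfD scale_scalar_mx.
rewrite raddfD /= -scale_scalar_mx scalerDr addrACA; congr (_ + _).
rewrite scaler_sumr -big_split; apply: eq_bigr => y _ /=.
by rewrite [mxeval k _]IHk mulmxDr scalemxAr.
Qed.

Lemma mxeval_one k : mxeval k (wf_one S) = 1.
Proof.
case: k => [|k] /=; first by rewrite addr0.
rewrite big1 ?addr0// => y _; rewrite [mxeval k _](_ : _ = 0) ?mulmx0//.
have /(eq_mxeval (k := k)) -> : forall w, (size w <= k)%N ->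
    wf_shift y (wf_one S) w = (fun=> 0) w by [].
elim: k => [|k IHk] /=; rewrite raddf0 add0r// big1// => z _.
by rewrite IHk mulmx0.
Qed.

Lemma mxeval_varM k x f : uniq Y -> x \in Y ->
  mxeval k.+1 (fun w => f w + if w is a :: v then (a == x)%:R * f v else 0) =
  mxeval k.+1 f + N x *m mxeval k f.
Proof.
move=> uY xY /=; rewrite addr0 -addrA; congr (_ + _).
under eq_bigr do rewrite [mxeval k _]mxeval_axpy mulmxDr.
rewrite big_split; congr (_ + _); rewrite (bigD1_seq x)//= eqxx scale1r.
by rewrite big1 ?addr0// => y /negPf ->; rewrite scale0r mulmx0.
Qed.

Hypothesis N_strict : forall x (i j : 'I_n), (j <= i)%N -> N x i j = 0.

(** The two sides differ by products of k + 1 strictly upper triangular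
    matrices, which vanish below the diagonal j = i + k + 1. *)
Lemma mxeval_diff k f (i j : 'I_n) :
  (j < i + k.+1)%N -> mxeval k.+1 f i j = mxeval k f i j.
Proof.
have evalS m h : mxeval m.+1 h =
  (h [::])%:M + \sum_(y <- Y) N y *m mxeval m (wf_shift y h) by [].
elim: k f i j => [|k IHk] f i j jik.
  rewrite evalS mxE summxE big1 => [|y _]; first by rewrite /= addr0 addr0.
  rewrite /= addr0 mul_mx_scalar mxE N_strict ?mulr0//.
  by move: jik; rewrite addn1.
rewrite (evalS k.+1) (evalS k) !mxE; congr (_ + _); rewrite !summxE.
apply: eq_bigr => y _; rewrite !mxE; apply: eq_bigr => l _.
have [li|il] := leqP l i; first by rewrite N_strict// !mul0r.
rewrite IHk//; apply: leq_trans jik _.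
by rewrite addnS -addSn leq_add2r.
Qed.

Lemma mxeval_stable k f : (n <= k.+1)%N -> mxeval k.+1 f = mxeval k f.
Proof.
move=> nk; apply/matrixP => i j; apply: mxeval_diff.
by rewrite (leq_trans (ltn_ord j))// (leq_trans nk)// leq_addl.
Qed.

End MatrixEvaluation.

(** Every homomorphism from F to unitriangular matrices is the Magnus expansion
    with x replaced by phi(x) - 1: both are multiplicative and agree on the
    basis. The alphabet varies with g since X may be infinite. *)
Lemma magnus_mxeval d (phi : ghom (freegroup X) (UT S d.+1)) (g : freegroup X) :
  exists Y, mxeval (fun x => utmx (phi (fgvar x)) - 1) Y d
                   (nccoef (unit_val (magnus S g))) = utmx (phi g).
Proof.
set N := (fun x : X => utmx (phi (fgvar x)) - 1).
have N_strict x (i j : 'I_d.+1) : (j <= i)%N -> N x i j = 0.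
  by move=> ji; rewrite /N -opprB mxE strict_upper_sub1// oppr0.
(* Stability under enlarging Y is needed to bring in a new letter. *)
suff [Y0 HY0] : exists Y0 : seq X, forall Y : seq X, uniq Y ->
    {subset Y0 <= Y} ->
    mxeval N Y d (nccoef (unit_val (magnus S g))) = utmx (phi g).
  exists (undup Y0); rewrite HY0 ?undup_uniq// => x.
  by rewrite mem_undup.
have step Y x (h : ncseries X S) : uniq Y -> x \in Y ->
    mxeval N Y d (nccoef ((1 + ncvar S x) * h)) =
    utmx (phi (fgvar x)) *m mxeval N Y d (nccoef h).
  (* One extra degree of truncation, harmless for matrices of size d + 1,
     leaves room for the multiplication by x. *)
  move=> uY xY; rewrite -!(mxeval_stable Y N_strict _ (leqnn d.+1)).
  rewrite (@eq_mxeval _ N Y d.+1 _ _ (fun w _ => coef_varM x h w)) mxeval_varM//.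
  rewrite (mxeval_stable Y N_strict _ (leqnn d.+1)).
  by rewrite -[X in X + _]mul1mx -mulmxDl addrC /N subrK.
elim/freegroup_ind: g => [|x g [Y0 HY0]|x g [Y0 HY0]].
- exists [::] => Y _ _; rewrite !gmulf1.
  exact: mxeval_one.
- exists (x :: Y0) => Y uY sY; rewrite magnusM magnus_var step ?sY ?mem_head//.
  rewrite HY0 ?[phi (_ * _)%g]gmulfM// => y yY; apply: sY.
  by rewrite inE yY orbT.
- exists (x :: Y0) => Y uY sY; have xY : x \in Y by rewrite sY ?mem_head.
  have sY0 : {subset Y0 <= Y} by move=> y yY; apply: sY; rewrite inE yY orbT.
  have := HY0 Y uY sY0; rewrite (magnus_varVM _ x) step// => E.
  rewrite [phi _]gmulfM [phi _^-1%g]gmulfV; set A := phi (fgvar x) in E *.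
  have AV : utmx A^-1%g *m utmx A = 1%:M := congr1 (@utmx _ _) (mulVg A).
  by rewrite -[LHS]mul1mx -AV -mulmxA E.
Qed.

(** By magnus_mxeval, phi g depends only on the Magnus coefficients of g of length
    at most d, which here are those of the neutral element. *)
Lemma hom_ut_eq1 d (phi : ghom (freegroup X) (UT S d.+1)) g :
  (forall w, (0 < size w <= d)%N -> magnus_coef S w g = 0) -> phi g = 1%g.
Proof.
move=> H; apply: val_inj; have [Y evalE] := magnus_mxeval phi g.
apply: etrans (esym evalE) _.
rewrite -[RHS](mxeval_one (fun x => utmx (phi (fgvar x)) - 1) Y d).
apply: eq_mxeval => w wd; have [->|w0] := eqVneq w [::].
  exact: magnus_coef0.
by rewrite [LHS]H ?lt0n ?size_eq0 ?w0// /wf_one (negPf w0).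
Qed.

Lemma magnus_rep_ker_factor w (g : freegroup X) : gker (magnus_rep S w) g ->
  forall i j, (i < j <= size w)%N -> magnus_coef S (drop i (take j w)) g = 0.
Proof.
move=> wg i j /andP[ij jw].
have iw := leq_ltn_trans (ltnW ij) (jw : (j < (size w).+1)%N).
have := congr1 (fun A : UT S (size w).+1 =>
  utmx A (Ordinal iw) (Ordinal (jw : (j < (size w).+1)%N))) wg.
by rewrite [LHS]magnus_mxE ?(ltnW ij)// => ->; rewrite mxE -val_eqE /= ltn_eqF.
Qed.

(** A word of length between 1 and d is a prefix of a word of length d, so its
    coefficient is an entry of the representation attached to the latter. The
    converse holds as for any homomorphism to unitriangular matrices. *)
Lemma magnus_rep_ker_coef d (g : freegroup X) :
  (forall w, size w = d -> gker (magnus_rep S w) g) <->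
  (forall w, (0 < size w <= d)%N -> magnus_coef S w g = 0).
Proof.
split=> H w.
  (* Repeating the first letter gives a padding whatever X is. *)
  case: w => // a v /= vd; pose w := (a :: v) ++ nseq (d - (size v).+1) a.
  have sw : size w = d by rewrite size_cat size_nseq /= subnKC.
  have := @magnus_rep_ker_factor w g (H w sw) 0%N (size (a :: v)).
  by rewrite sw take_size_cat// drop0; apply.
by move=> wd; apply: hom_ut_eq1 => v; rewrite wd; exact: H.
Qed.

End Evaluation.

(** * The three subgroups *)

Theorem theorem5p3 (X : choiceType) (R : comPzRingType)
    (e : nat -> nat -> nat) (he : mult_descending e) (n : nat) (hn : (1 <= n)%N) :
  (fun g : freegroup X => unit_val (magnus R g)) @^-1`
      [set 1 + a | a in aug_filtration X R e n]
    = \bigcap_(d in [set d : nat | (1 <= d <= n.-1)%N])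
        \bigcap_(phi in [set: ghom (freegroup X) (UT (modnat R (e n d)) d.+1)])
          gker phi
  /\
  \bigcap_(d in [set d : nat | (1 <= d <= n.-1)%N])
     \bigcap_(phi in [set: ghom (freegroup X) (UT (modnat R (e n d)) d.+1)])
       gker phi
    = \bigcap_(d in [set d : nat | (1 <= d <= n.-1)%N])
        \bigcap_(w in [set w : seq X | size w = d])
          gker (magnus_rep (modnat R (e n d)) w).
Proof.
have hom_rep : \bigcap_(d in [set d : nat | (1 <= d <= n.-1)%N])
     \bigcap_(phi in [set: ghom (freegroup X) (UT (modnat R (e n d)) d.+1)])
       gker phi
    = \bigcap_(d in [set d : nat | (1 <= d <= n.-1)%N])
        \bigcap_(w in [set w : seq X | size w = d])
          gker (magnus_rep (modnat R (e n d)) w).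
  apply: eq_bigcapr => d _; apply/seteqP; split=> g Hg.
    by move=> w wd; move: wd Hg => /= <- Hg; exact: Hg (magnus_rep _ w) _.
  move=> phi _; apply: hom_ut_eq1.
  by apply/magnus_rep_ker_coef.
split=> //; rewrite hom_rep; apply/seteqP; split=> g.
  move=> /(magnus_aug_filtrationP _ _ he hn) Hg d /andP[d0 dn].
  apply/magnus_rep_ker_coef => v /andP[v0 vd]; apply/magnus_coef_modnat.
  have d_lt_n : (d < n)%N by rewrite -(prednK hn) ltnS.
  apply: (@multiples_dvdn _ _ (e n (size v))).
    by apply: mult_descending_dvdn => //; [rewrite v0|exact: ltnW].
  by apply: Hg; rewrite v0 (leq_ltn_trans vd).
move=> Hg; apply/(magnus_aug_filtrationP _ _ he hn) => w /andP[w0 wn].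
apply/magnus_coef_modnat; have := Hg (size w).
rewrite /= w0 -ltnS (prednK hn) wn => /(_ isT) /magnus_rep_ker_coef; apply.
by rewrite w0 leqnn.
Qed.
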